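(* For $k\ge1$, $$W_{111\text{-}1}(x;k)=\sum_{j=1}^k\frac{(k-j)!\binom{k}{j}\bigl(1+x(1+x)+\delta_{j,1}x^3\bigr)x^{3(k-j)}}{\prod_{i=j}^k\bigl(1-(i-1)x(1+x)\bigr)},$$ where $\delta_{j,1}$ is the Kronecker delta.
   Context: For $k\ge1$ let $[k]=\{1,\dots,k\}$; a $k$-ary word of length $n$ is an element of $[k]^n$. A word $w=w_1\cdots w_n$ contains the vincular pattern $111\text{-}1$ if there are indices $p$ and $q\ge p+3$ with $w_p=w_{p+1}=w_{p+2}=w_q$; otherwise it avoids it. $a_{111\text{-}1}(n,k)$ is the number of words in $[k]^n$ avoiding $111\text{-}1$ (with $a(0,k)=1$), and $W_{111\text{-}1}(x;k)=\sum_{n\ge0}a_{111\text{-}1}(n,k)x^n$. *)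

(* Defs.v *)
From HB Require Import structures.
From mathcomp Require Import all_boot all_order all_algebra.
From mathcomp Require Import boolp.

Set Implicit Arguments.
Unset Strict Implicit.
Unset Printing Implicit Defensive.

Import GRing.Theory.

Local Open Scope ring_scope.

(* The ring R[[x]] of formal power series. A record, rather than [nat -> R]
   itself, so that its product is the Cauchy product and not a pointwise one. *)
Record fps (R : Type) := Fps { fpscoef : nat -> R }.

Lemma fpsP (R : Type) (f g : fps R) : fpscoef f =1 fpscoef g -> f = g.
Proof. by case: f g => [f] [g] /= fg; congr Fps; apply: funext. Qed.

HB.instance Definition _ (R : Type) := gen_eqMixin (fps R).
HB.instance Definition _ (R : Type) := gen_choiceMixin (fps R).

Definition fps_zero (R : zmodType) : fps R := Fps (fun _ => 0).
Definition fps_opp (R : zmodType) (f : fps R) : fps R :=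
  Fps (fun n => - fpscoef f n).
Definition fps_add (R : zmodType) (f g : fps R) : fps R :=
  Fps (fun n => fpscoef f n + fpscoef g n).

Fact fps_addA (R : zmodType) : associative (@fps_add R).
Proof. by move=> f g h; apply: fpsP => n; apply: addrA. Qed.
Fact fps_addC (R : zmodType) : commutative (@fps_add R).
Proof. by move=> f g; apply: fpsP => n; apply: addrC. Qed.
Fact fps_add0 (R : zmodType) : left_id (@fps_zero R) (@fps_add R).
Proof. by move=> f; apply: fpsP => n; apply: add0r. Qed.
Fact fps_addN (R : zmodType) :
  left_inverse (@fps_zero R) (@fps_opp R) (@fps_add R).
Proof. by move=> f; apply: fpsP => n; apply: addNr. Qed.

HB.instance Definition _ (R : zmodType) :=
  GRing.isZmodule.Build (fps R)
    (@fps_addA R) (@fps_addC R) (@fps_add0 R) (@fps_addN R).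

Definition fps_one (R : comNzRingType) : fps R := Fps (fun n => (n == 0)%:R).
Definition fps_mul (R : comNzRingType) (f g : fps R) : fps R :=
  Fps (fun n => \sum_(i < n.+1) fpscoef f i * fpscoef g (n - i)).

Fact fps_mulC (R : comNzRingType) : commutative (@fps_mul R).
Proof.
move=> f g; apply: fpsP => n /=; rewrite (reindex_inj rev_ord_inj) /=.
by apply: eq_bigr => i _; rewrite subSS mulrC subKn // -ltnS.
Qed.

Fact fps_coef_mul_rev (R : comNzRingType) (f g : fps R) n :
  fpscoef (fps_mul f g) n = \sum_(i < n.+1) fpscoef f (n - i) * fpscoef g i.
Proof. by rewrite fps_mulC /=; apply: eq_bigr => i _; rewrite mulrC. Qed.

Fact fps_mulA (R : comNzRingType) : associative (@fps_mul R).
Proof.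
move=> p q r; apply: fpsP => i; rewrite [RHS]fps_coef_mul_rev [LHS]/=.
pose coef3 j k := fpscoef p j * (fpscoef q (i - j - k) * fpscoef r k).
transitivity (\sum_(j < i.+1) \sum_(k < i.+1 | (k <= i - j)%N) coef3 j k).
  apply: eq_bigr => /= j _.
  rewrite -[X in _ * X]/(fpscoef (fps_mul q r) (i - j)) fps_coef_mul_rev.
  by rewrite big_distrr /= (big_ord_narrow_leq (leq_subr _ _)).
rewrite (exchange_big_dep predT) //=; apply: eq_bigr => k _.
transitivity (\sum_(j < i.+1 | (j <= i - k)%N) coef3 j k).
  apply: eq_bigl => j; rewrite -ltnS -(ltnS j) -!subSn ?leq_ord //.
  by rewrite -subn_gt0 -(subn_gt0 j) -!subnDA addnC.
rewrite (big_ord_narrow_leq (leq_subr _ _)) big_distrl /=.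
by apply: eq_bigr => j _; rewrite /coef3 -!subnDA addnC mulrA.
Qed.

Fact fps_mul1 (R : comNzRingType) : left_id (@fps_one R) (@fps_mul R).
Proof.
move=> f; apply: fpsP => n /=; rewrite big_ord_recl /= mul1r subn0.
by rewrite big1 ?addr0 // => i _; rewrite mul0r.
Qed.

Fact fps_mulDl (R : comNzRingType) :
  left_distributive (@fps_mul R) (@fps_add R).
Proof.
move=> f g h; apply: fpsP => n /=; rewrite -big_split /=.
by apply: eq_bigr => i _; rewrite mulrDl.
Qed.

Fact fps_one_neq0 (R : comNzRingType) : fps_one R != 0.
Proof.
by apply/eqP => /(congr1 (fun f => fpscoef f 0)) /eqP; rewrite /= oner_eq0.
Qed.

HB.instance Definition _ (R : comNzRingType) :=
  GRing.Zmodule_isComNzRing.Build (fps R)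
    (@fps_mulA R) (@fps_mulC R) (@fps_mul1 R) (@fps_mulDl R) (@fps_one_neq0 R).

(* The first n coefficients of 1 / f, from the recurrence
   f_0 g_m = [m = 0] - \sum_(i < m) f_(m - i) g_i. *)
Fixpoint fps_inv_seq (R : comUnitRingType) (f : fps R) (n : nat) : seq R :=
  if n is m.+1 then
    let s := fps_inv_seq f m in
    rcons s ((fpscoef f 0)^-1 *
             ((m == 0)%:R - \sum_(i < m) fpscoef f (m - i) * s`_i))
  else [::].

Definition fps_unit (R : comUnitRingType) : {pred fps R} :=
  [pred f | fpscoef f 0 \is a GRing.unit].

Definition fps_inv (R : comUnitRingType) (f : fps R) : fps R :=
  if f \in @fps_unit R then Fps (fun n => (fps_inv_seq f n.+1)`_n) else f.

Lemma size_fps_inv_seq (R : comUnitRingType) (f : fps R) n :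
  size (fps_inv_seq f n) = n.
Proof. by elim: n => //= n IHn; rewrite size_rcons IHn. Qed.

Lemma nth_fps_inv_seq (R : comUnitRingType) (f : fps R) n i :
  (i < n)%N -> (fps_inv_seq f n)`_i = (fps_inv_seq f i.+1)`_i.
Proof.
elim: n => // n IHn; rewrite ltnS leq_eqVlt => /predU1P[-> //|ltin].
by rewrite [LHS]/= nth_rcons size_fps_inv_seq ltin IHn.
Qed.

Fact fps_mulV (R : comUnitRingType) :
  {in @fps_unit R, left_inverse 1 (@fps_inv R) *%R}.
Proof.
move=> f Uf; apply: fpsP => n; rewrite /fps_inv Uf mulrC.
rewrite [LHS]fps_coef_mul_rev big_ord_recr subnn.
have -> : fpscoef f 0 * (fps_inv_seq f n.+1)`_n =
    (n == 0)%:R - \sum_(i < n) fpscoef f (n - i) * (fps_inv_seq f i.+1)`_i.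
  rewrite [fps_inv_seq _ _]/= nth_rcons size_fps_inv_seq ltnn eqxx mulVKr //.
  congr (_ - _); apply: eq_bigr => i _.
  by rewrite (nth_fps_inv_seq f (ltn_ord i)).
exact: etrans (addrC _ _) (subrK _ _).
Qed.

Fact fps_unitP (R : comUnitRingType) (f g : fps R) :
  g * f = 1 -> @fps_unit R f.
Proof.
move=> /(congr1 (fun h => fpscoef h 0)) /=; rewrite big_ord1 subn0 => gf1.
by apply/unitrPr; exists (fpscoef g 0); rewrite mulrC.
Qed.

Fact fps_inv_out (R : comUnitRingType) :
  {in [predC @fps_unit R], @fps_inv R =1 id}.
Proof. by move=> f; rewrite inE /fps_inv => /negbTE ->. Qed.

HB.instance Definition _ (R : comUnitRingType) :=
  GRing.ComNzRing_hasMulInverse.Build (fps R)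
    (@fps_mulV R) (@fps_unitP R) (@fps_inv_out R).

Lemma fps_unitE (R : comUnitRingType) (f : fps R) :
  (f \is a GRing.unit) = (fpscoef f 0 \is a GRing.unit).
Proof. by []. Qed.

Definition fpsX (R : comNzRingType) : fps R := Fps (fun n => (n == 1)%:R).
Arguments fpsX {R}.

(* Positions are counted from 0. As p + 3 <= q < size w, all four positions
   are valid, so [onth] never returns [None] here. *)
Definition contains_111_1 (T : eqType) (w : seq T) : bool :=
  [exists p : 'I_(size w), [exists q : 'I_(size w),
    [&& (p + 3 <= q)%N, onth w p == onth w p.+1,
        onth w p.+1 == onth w p.+2 & onth w p.+2 == onth w q]]].

(* The alphabet {1, ..., k} is represented by 'I_k = {0, ..., k - 1}. *)
Definition a_111_1 (n k : nat) : nat :=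
  #|[set w : n.-tuple 'I_k | ~~ contains_111_1 w]|.

Definition W_111_1 (k : nat) : fps int := Fps (fun n => (a_111_1 n k)%:R).

(* Denominators of the closed form of W_111_1: dividing by them is genuine
   division, as they are invertible in Z[[x]]. *)
Lemma W_den_unit (j k : nat) :
  \prod_(j <= i < k.+1) (1 - (i%:R - 1) * (fpsX * (1 + fpsX)))
    \is a @GRing.unit (fps int).
Proof.
apply: rpred_prod => i _; rewrite fps_unitE.
suff -> (f g : fps int) : fpscoef (1 - f * (fpsX * g)) 0 = 1 by rewrite unitr1.
by rewrite mulrCA /= big_ord1 mul0r subr0.
Qed.

(* Main.v *)
Require Import Defs.
From HB Require Import structures.
From mathcomp Require Import all_boot all_order all_algebra.
From mathcomp Require Import zify ring.

Set Implicit Arguments.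
Unset Strict Implicit.
Unset Printing Implicit Defensive.

Import GRing.Theory.

Local Open Scope ring_scope.

(** Split an avoiding word according to its first run, of some letter [a].
    If the run has length 1 or 2, what follows is empty or an arbitrary avoiding
    word not starting with [a]; otherwise the run has length exactly 3 and what
    follows is an arbitrary avoiding word on the other letters. With
    [r = x (1 + x)] this gives
    [(1 - k r) W_(k+1) = 1 + r + (k + 1) x^3 W_k] and [W_0 = 1], a first-order
    recurrence in [k] which the closed form also satisfies. *)

Lemma contains_111_1P (T : eqType) (w : seq T) :
  reflect (exists p q, [/\ (p + 3 <= q < size w)%N, onth w p = onth w p.+1,
             onth w p.+1 = onth w p.+2 & onth w p.+2 = onth w q])
          (contains_111_1 w).
Proof.
apply: (iffP existsP) => [[p /existsP[q /and4P[lepq /eqP e1 /eqP e2 /eqP e3]]]|].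
  by exists p, q; rewrite lepq ltn_ord.
move=> [p [q [/andP[lepq ltq] e1 e2 e3]]].
have ltp : (p < size w)%N by lia.
exists (Ordinal ltp); apply/existsP; exists (Ordinal ltq).
by apply/and4P; split=> //; apply/eqP.
Qed.

Lemma contains_111_1_short (T : eqType) (w : seq T) :
  (size w <= 3)%N -> contains_111_1 w = false.
Proof. by move=> sw; apply/contains_111_1P => -[p [q []]]; lia. Qed.

Lemma contains_111_1_cons (T : eqType) (a : T) (w : seq T) :
  contains_111_1 (a :: w) =
  [&& onth w 0 == Some a, onth w 1 == Some a & a \in drop 2 w]
    || contains_111_1 w.
Proof.
apply/contains_111_1P/orP => [[[|p] [[|q] []]] //=|].
- move=> lq e1 e2 e3; left; rewrite -e2 -e1 eqxx /=.
  (* Here [q] is a position in [w], and [drop 2] shifts it by two. *)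
  apply/(nthP a); exists (q - 2)%N; first by rewrite size_drop; lia.
  rewrite nth_drop; have -> : (2 + (q - 2) = q)%N by lia.
  have ltq : (q < size w)%N by lia.
  by apply: Some_inj; rewrite e1 e2 e3; rewrite (onthE w) (nth_map a).
- move=> lq e1 e2 e3; right; apply/contains_111_1P; exists p, q.
  by split=> //; lia.
- case=> [/and3P[/eqP e0 /eqP e1 /(nthP a)[q]]|/contains_111_1P[p [q [lq *]]]].
    rewrite size_drop nth_drop => ltq eq_a; exists 0%N, (2 + q).+1.
    split; first by rewrite /=; lia.
    - by rewrite -[RHS]/(onth w 0) e0.
    - by rewrite -[LHS]/(onth w 0) -[RHS]/(onth w 1) e0 e1.
    rewrite -[LHS]/(onth w 1) -[RHS]/(onth w (2 + q)) e1.
    by rewrite onthE (nth_map a) ?eq_a //; lia.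
  by exists p.+1, q.+1; split => //=; lia.
Qed.

Lemma contains_111_1_cons_neq (T : eqType) (a : T) (w : seq T) :
  ohead w != Some a -> contains_111_1 (a :: w) = contains_111_1 w.
Proof.
rewrite contains_111_1_cons => ha; case: w ha => [|b w] //= ha.
by rewrite (negbTE ha).
Qed.

(** The leading run has length exactly two, too short for an occurrence to start in it. *)
Lemma contains_111_1_cons2_neq (T : eqType) (a : T) (w : seq T) :
  ohead w != Some a -> contains_111_1 [:: a, a & w] = contains_111_1 w.
Proof.
move=> ha; rewrite contains_111_1_cons contains_111_1_cons_neq //=.
case: w ha => [|b w] /= ha; first by rewrite andbF.
by rewrite (negbTE ha) andbF.
Qed.

(** Any later [a] completes the pattern begun by the three leading ones. If there is none, the run
    stops before [w], and its last two letters can be removed as a run of length two. *)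
Lemma contains_111_1_cons3 (T : eqType) (a : T) (w : seq T) :
  contains_111_1 [:: a, a, a & w] = (a \in w) || contains_111_1 w.
Proof.
rewrite contains_111_1_cons /= !eqxx drop0 /=.
have [//|aNw] := boolP (a \in w); rewrite contains_111_1_cons2_neq //.
by case: w aNw => //= b w; rewrite inE negb_or eq_sym => /andP[].
Qed.

Lemma contains_111_1_map (T U : eqType) (f : T -> U) (w : seq T) :
  injective f -> contains_111_1 (map f w) = contains_111_1 w.
Proof.
move=> finj; elim: w => [|a w IHw];
  first by rewrite !contains_111_1_short.
rewrite /= !contains_111_1_cons IHw; congr (_ || _).
rewrite -map_drop mem_map // !onth_map.
have ofP (o : option T) : (omap f o == Some (f a)) = (o == Some a).
  by case: o => //= b; rewrite !(inj_eq Some_inj) inj_eq.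
by rewrite !ofP.
Qed.

Local Open Scope nat_scope.

Lemma sum_tupleS (T : finType) n (F : seq T -> nat) :
  \sum_(w : n.+1.-tuple T) F w = \sum_(a : T) \sum_(w : n.-tuple T) F (a :: w).
Proof.
rewrite pair_big /=.
rewrite (reindex (fun u : T * n.-tuple T => [tuple of u.1 :: u.2])) //=.
exists (fun w : n.+1.-tuple T => (thead w, [tuple of behead w])) => [[a w] _|w _].
  by rewrite theadE; congr pair; apply: val_inj.
by rewrite /= -tuple_eta.
Qed.

(** Peels one letter off a leading run of [a]: the first sum is the case where the run has already
    ended, the second the case where it continues. *)
Lemma sum_tuple_head (T : finType) (a : T) n (F : seq T -> nat) :
  \sum_(w : n.+1.-tuple T) F w =
  \sum_(w : n.+1.-tuple T) (ohead w != Some a) * F w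
  + \sum_(w : n.-tuple T) F (a :: w).
Proof.
rewrite (sum_tupleS _ (fun w => (ohead w != Some a) * F w)) sum_tupleS.
rewrite (bigD1 a) //= addnC; congr (_ + _).
rewrite [RHS](bigD1 a) //= eqxx [X in _ = X + _]big1 ?add0n //.
by apply: eq_bigr => b ba; apply: eq_bigr => w _;
  rewrite (inj_eq Some_inj) ba mul1n.
Qed.

(** [lift a] relabels the smaller alphabet as the letters other than [a]; this is how [W_k] enters
    the recurrence for [W_(k+1)]. *)
Lemma sum_tuple_notin k (a : 'I_k.+1) n (F : seq 'I_k.+1 -> nat) :
  \sum_(w : n.-tuple 'I_k.+1) (a \notin tval w) * F w =
  \sum_(w : n.-tuple 'I_k) F (map (lift a) w).
Proof.
elim: n F => [|n IHn] F.
  rewrite (big_pred1 [tuple]) ?(big_pred1 [tuple]) ?mul1n // => w;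
  by rewrite [w]tuple0 /= eqxx.
rewrite (sum_tupleS _ (fun w => (a \notin w) * F w)).
rewrite (sum_tupleS _ (fun w => F (map (lift a) w))) (bigD1_ord a) //=.
rewrite big1 ?add0n => [|w _]; last by rewrite inE eqxx.
apply: eq_bigr => b _; rewrite -(IHn (fun w => F (lift a b :: w))).
by apply: eq_bigr => w _; rewrite inE negb_or neq_lift.
Qed.

Lemma a_111_1E n k :
  a_111_1 n k = \sum_(w : n.-tuple 'I_k) ~~ contains_111_1 w.
Proof. by rewrite /a_111_1 cardsE -sum1_card big_mkcond. Qed.

Lemma a_111_1_short n k : n <= 3 -> a_111_1 n k = k ^ n.
Proof.
move=> le_n3; rewrite a_111_1E -[in RHS](card_ord k) -card_tuple -sum1_card.
by apply: eq_bigr => w _; rewrite contains_111_1_short ?size_tuple.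
Qed.

Lemma a_111_1_0 n : a_111_1 n 0 = (n == 0).
Proof.
case: n => [|n]; first by rewrite a_111_1_short.
by rewrite a_111_1E (sum_tupleS _ (fun w => ~~ contains_111_1 w : nat)) big_ord0.
Qed.

(** Double counting: a nonempty word is counted once for each of the [k] letters other than its
    head. The empty word would be counted [k.+1] times, hence the length [n.+1]. *)
Lemma sum_head_neq n k (F : seq 'I_k.+1 -> nat) :
  \sum_a \sum_(w : n.+1.-tuple 'I_k.+1) (ohead w != Some a) * F w =
  k * \sum_(w : n.+1.-tuple 'I_k.+1) F w.
Proof.
rewrite exchange_big big_distrr /=; apply: eq_bigr => w _.
rewrite -big_distrl /=; congr (_ * _).
case/tupleP: w => b w /=; rewrite (bigD1_ord b) //= eqxx add0n.
rewrite (eq_bigr (fun=> 1)) => [|a _]; first by rewrite sum1_card card_ord.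
by rewrite (inj_eq Some_inj) neq_lift.
Qed.

Lemma a_111_1_rec n k :
  a_111_1 n.+3 k.+1 =
  k * (a_111_1 n.+2 k.+1 + a_111_1 n.+1 k.+1) + k.+1 * a_111_1 n k.
Proof.
rewrite !a_111_1E mulnDr.
pose av (w : seq 'I_k.+1) : nat := ~~ contains_111_1 w.
rewrite (sum_tupleS _ av).
(* Splitting twice separates first runs of length 1, 2 and at least 3, which give the three terms of
   the recurrence. *)
under eq_bigr => a _ do
  rewrite (sum_tuple_head a _ (fun w => av (a :: w)))
          (sum_tuple_head a _ (fun w => av [:: a, a & w])) addnA.
rewrite 2!big_split /=; congr (_ + _ + _).
- rewrite -(sum_head_neq _ av); apply: eq_bigr => a _; apply: eq_bigr => w _.
  have [ha|//] := boolP (ohead w != Some a).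
  by rewrite /av contains_111_1_cons_neq.
- rewrite -(sum_head_neq _ av); apply: eq_bigr => a _; apply: eq_bigr => w _.
  have [ha|//] := boolP (ohead w != Some a).
  by rewrite /av contains_111_1_cons2_neq.
rewrite -[in RHS](card_ord k.+1) -sum_nat_const; apply: eq_bigr => a _.
transitivity (\sum_(w : n.-tuple 'I_k.+1) (a \notin tval w) * av w).
  apply: eq_bigr => w _; rewrite /av contains_111_1_cons3 negb_or.
  by rewrite mulnb.
rewrite sum_tuple_notin; apply: eq_bigr => w _.
by rewrite /av contains_111_1_map //; apply: lift_inj.
Qed.

Local Open Scope ring_scope.

Lemma fpscoefXM (R : comNzRingType) (f : fps R) n :
  fpscoef (fpsX * f) n = if n is m.+1 then fpscoef f m else 0.
Proof.
case: n => [|n]; first by rewrite /= big_ord1 mul0r.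
rewrite /= big_ord_recl mul0r add0r big_ord_recl /= mul1r subn1 /=.
by rewrite big1 ?addr0 // => i _; rewrite mul0r.
Qed.

Lemma fpscoefMnatl (R : comNzRingType) (f : fps R) m n :
  fpscoef (m%:R * f) n = m%:R * fpscoef f n.
Proof.
rewrite !mulr_natl; elim: m => [|m IHm]; first by rewrite !mulr0n.
by rewrite !mulrS -IHm.
Qed.

Lemma W_111_1_0 : W_111_1 0 = 1.
Proof. by apply: fpsP => n; rewrite /= a_111_1_0. Qed.

Lemma W_111_1_rec k :
  (1 - (k.+1%:R - 1) * (fpsX * (1 + fpsX))) * W_111_1 k.+1 =
  1 + fpsX * (1 + fpsX) + k.+1%:R * fpsX ^+ 3 * W_111_1 k.
Proof.
(* Free of subtraction and with powers of [fpsX] nested, so that each coefficient is read off by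
   index shifts. *)
suff WE : W_111_1 k.+1 =
    1 + fpsX * (1 + fpsX * 1)
    + k%:R * (fpsX * (W_111_1 k.+1 + fpsX * W_111_1 k.+1))
    + k.+1%:R * (fpsX * (fpsX * (fpsX * W_111_1 k))).
  rewrite -natr1 addrK mulrBl mul1r [X in X - _]WE; ring.
have coefD (f g : fps int) n : fpscoef (f + g) n = fpscoef f n + fpscoef g n.
  by [].
apply: fpsP => n; rewrite !(coefD, fpscoefMnatl, fpscoefXM).
(* Coefficients 0, 1 and 2 lie below the range of the recurrence; there every word avoids the
   pattern. *)
case: n => [|[|[|n]]]; rewrite ?(coefD, fpscoefXM) /=;
  last by rewrite a_111_1_rec; ring.
- by rewrite a_111_1_short //; ring.
- by rewrite !a_111_1_short //; ring.
- by rewrite !a_111_1_short //; ring.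
Qed.

Theorem theorem4p2 (k : nat) (hk : (1 <= k)%N) :
  W_111_1 k =
  \sum_(1 <= j < k.+1)
    ((k - j)`! * 'C(k, j))%:R
      * (1 + fpsX * (1 + fpsX) + (j == 1%N)%:R * fpsX ^+ 3)
      * fpsX ^+ (3 * (k - j))
    / \prod_(j <= i < k.+1) (1 - (i%:R - 1) * (fpsX * (1 + fpsX))).
Proof.
have den_unit i :
    1 - (i%:R - 1) * (fpsX * (1 + fpsX)) \is a @GRing.unit (fps int).
  by have := W_den_unit i i; rewrite big_nat1.
case: k hk => // k _; elim: k => [|k IHk].
  (* For one letter the term [x^3 W_0 = x^3] of the recurrence is exactly the Kronecker delta
     term. *)
  apply: (mulrI (den_unit 1%N)); rewrite W_111_1_rec W_111_1_0 !big_nat1.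
  by rewrite subrr mul0r subr0 divr1 subnn !mul1r !mulr1.
apply: (mulrI (den_unit k.+2)); rewrite W_111_1_rec IHk.
(* The summand [j = k.+2] yields [1 + x (1 + x)]; the others match [k.+2 x^3 W_(k+1)] term by
   term. *)
rewrite [in RHS]big_nat_recr //= [RHS]mulrDr [LHS]addrC; congr (_ + _); last first.
  rewrite big_nat1 subnn binn mul1r muln0 mulr1 mul0r addr0.
  by rewrite [RHS]mulrC divrK.
rewrite !big_distrr /=; apply: eq_big_nat => j /andP[j_gt0 le_jk].
rewrite [in RHS]big_nat_recr /=; last by lia.
rewrite invrM ?W_den_unit // (subSn (le_jk : (j <= k.+1)%N)).
have -> : ((k.+1 - j).+1`! * 'C(k.+2, j) =
    k.+2 * ((k.+1 - j)`! * 'C(k.+1, j)))%N.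
  by rewrite factS mulnAC -subSn // -mul_bin_down mulnAC mulnA.
have -> : (3 * (k.+1 - j).+1 = 3 + 3 * (k.+1 - j))%N by lia.
rewrite exprD natrM.
move: (den_unit k.+2).
set d := 1 - (k.+2%:R - 1) * _; set p := \prod_(j <= i < _) _ => Ud.
(* Inserting [d * d^-1] on the left balances the extra inverse on the right, so [ring] can treat
   both inverses as free variables. *)
rewrite -[LHS](mulVKr Ud); move: d^-1 p^-1 => d' p'; ring.
Qed.
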